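(* Let $K$ be a field, $\lambda\in K$, and let $(C,\mu,\Delta,\alpha,\beta,\psi,\omega)$ be a $\lambda$-infBH-bialgebra over $K$. Let $\Delta_\star:C\to C\otimes C$ be given by $$\Delta_\star(c)=\omega(c_{12})\otimes\beta\psi^2(c_{11})\,\alpha\psi\omega^2(c_2),\qquad c\in C.$$ Then $(C,\Delta_\star,\psi',\omega')$ with $\psi'=\alpha\beta\psi^2\omega^2$ and $\omega'=\psi\omega^2$ is a (left) BiHom-pre-Lie coalgebra.
   Context: Write $ab=\mu(a\otimes b)$, $\Delta(c)=c_1\otimes c_2$ and $(\Delta\otimes\mathrm{id})\Delta(c)=c_{11}\otimes c_{12}\otimes c_2$ (Sweedler notation). A $\lambda$-infBH-bialgebra $(C,\mu,\Delta,\alpha,\beta,\psi,\omega)$ consists of a vector space $C$ and linear maps $\mu:C\otimes C\to C$, $\Delta:C\to C\otimes C$, $\alpha,\beta,\psi,\omega:C\to C$ (not assumed invertible) such that: (i) (BiHom-associative algebra) $\alpha\beta=\beta\alpha$, $\alpha(ab)=\alpha(a)\alpha(b)$, $\beta(ab)=\beta(a)\beta(b)$, $\alpha(a)(bc)=(ab)\beta(c)$; (ii) (BiHom-coassociative coalgebra) $\psi\omega=\omega\psi$, $(\psi\otimes\psi)\Delta=\Delta\psi$, $(\omega\otimes\omega)\Delta=\Delta\omega$, $(\Delta\otimes\psi)\Delta=(\omega\otimes\Delta)\Delta$; (iii) $\alpha,\beta$ commute with $\psi,\omega$; $(\alpha\otimes\alpha)\Delta=\Delta\alpha$, $(\beta\otimes\beta)\Delta=\Delta\beta$;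 $\psi(ab)=\psi(a)\psi(b)$, $\omega(ab)=\omega(a)\omega(b)$; (iv) $\Delta(ab)=\omega(a)b_1\otimes\beta(b_2)+\alpha(a_1)\otimes a_2\psi(b)+\lambda\,\alpha\omega(a)\otimes\beta\psi(b)$. A (left) BiHom-pre-Lie coalgebra $(C,\delta,\psi',\omega')$ consists of a vector space $C$ and linear maps $\delta:C\to C\otimes C$ (written $\delta(c)=c_{[1]}\otimes c_{[2]}$), $\psi',\omega':C\to C$ with $\psi'\omega'=\omega'\psi'$, $\delta\psi'=(\psi'\otimes\psi')\delta$, $\delta\omega'=(\omega'\otimes\omega')\delta$ and $\bar\delta-\Phi_{(12)}\bar\delta=0$, where $\bar\delta(c)=\omega'\psi'(c_{[1]})\otimes\omega'(c_{[2][1]})\otimes c_{[2][2]}-\psi'(c_{[1][1]})\otimes\omega'(c_{[1][2]})\otimes\psi'(c_{[2]})$ and $\Phi_{(12)}(a\otimes b\otimes c)=b\otimes a\otimes c$. *)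

(* Defs.v *)
From HB Require Import structures.
From mathcomp Require Import all_boot all_algebra.
From mathcomp Require Import boolp.

Set Implicit Arguments.
Unset Strict Implicit.
Unset Printing Implicit Defensive.

Import GRing.Theory.
Local Open Scope ring_scope.
Local Open Scope quotient_scope.

(* The tensor product of two vector spaces of arbitrary dimension.  The list
   [:: (x1, y1); ...; (xn, yn)] stands for x1 (x) y1 + ... + xn (x) yn, and
   [tens_rel] is the congruence generated by the defining relations; lists need
   no coefficients, these being absorbed by either factor. *)
Inductive tens_rel (K : fieldType) (V W : lmodType K) :
    seq (V * W) -> seq (V * W) -> Prop :=
| tens_refl s : tens_rel s s
| tens_sym s t : tens_rel s t -> tens_rel t s
| tens_trans s t u : tens_rel s t -> tens_rel t u -> tens_rel s u
| tens_cat s s' t t' :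
    tens_rel s s' -> tens_rel t t' -> tens_rel (s ++ t) (s' ++ t')
| tens_catC s t : tens_rel (s ++ t) (t ++ s)
| tens_add_l x x' y : tens_rel [:: (x + x', y)] [:: (x, y); (x', y)]
| tens_add_r x y y' : tens_rel [:: (x, y + y')] [:: (x, y); (x, y')]
| tens_scale a x y : tens_rel [:: (a *: x, y)] [:: (x, a *: y)]
| tens_zero y : tens_rel [:: (0, y)] [::].

Section Tensor.
Variables (K : fieldType) (V W : lmodType K).
Implicit Types (s t : seq (V * W)) (a b : K).

Definition tens_relb s t : bool := `[< tens_rel s t >].

Lemma tens_relb_refl : reflexive tens_relb.
Proof. by move=> s; apply/asboolP; apply: tens_refl. Qed.

Lemma tens_relb_sym : symmetric tens_relb.
Proof.
by move=> s t; apply/asboolP/asboolP => h; apply: tens_sym.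
Qed.

Lemma tens_relb_trans : transitive tens_relb.
Proof.
by move=> t s u /asboolP h1 /asboolP h2; apply/asboolP; apply: tens_trans h1 h2.
Qed.

Canonical tens_equiv :=
  EquivRel tens_relb tens_relb_refl tens_relb_sym tens_relb_trans.

Definition tensor : Type := {eq_quot tens_equiv}.

HB.instance Definition _ : EqQuotient _ tens_equiv tensor :=
  EqQuotient.on tensor.
HB.instance Definition _ := Choice.on tensor.

Lemma tens_eqP s t : (\pi_tensor s = \pi_tensor t) <-> tens_rel s t.
Proof.
split=> [/eqmodP/asboolP//|h]; apply/eqmodP; exact/asboolP.
Qed.

Lemma tens_reprP s : tens_rel (repr (\pi_tensor s)) s.
Proof. by apply/tens_eqP; rewrite reprK. Qed.

Lemma tens_pi (u : tensor) : exists s, u = \pi_tensor s.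
Proof. by exists (repr u); rewrite reprK. Qed.

Definition tens (x : V) (y : W) : tensor := \pi_tensor [:: (x, y)].

Definition fscale a s := [seq (a *: p.1, p.2) | p <- s].

Definition tens_add (u v : tensor) : tensor := \pi_tensor (repr u ++ repr v).
Definition tens_opp (u : tensor) : tensor := \pi_tensor (fscale (-1) (repr u)).
Definition tens_mul a (u : tensor) : tensor := \pi_tensor (fscale a (repr u)).

Lemma fscale_rel a s t : tens_rel s t -> tens_rel (fscale a s) (fscale a t).
Proof.
elim=> {s t} [s|s t _|s t u _ h1 _|s s' t t' _ h1 _ h2|s t|x x' y|x y y'|b x y|y].
- exact: tens_refl.
- exact: tens_sym.
- exact: tens_trans.
- by rewrite /fscale !map_cat; apply: tens_cat.
- by rewrite /fscale !map_cat; apply: tens_catC.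
- by rewrite /= scalerDr; apply: tens_add_l.
- exact: tens_add_r.
- by rewrite /= scalerA mulrC -scalerA; apply: tens_scale.
- by rewrite /= scaler0; apply: tens_zero.
Qed.

Lemma pi_cat s t : tens_add (\pi_tensor s) (\pi_tensor t) = \pi_tensor (s ++ t).
Proof. by apply/tens_eqP; apply: tens_cat; apply: tens_reprP. Qed.

Lemma pi_fscale a s : tens_mul a (\pi_tensor s) = \pi_tensor (fscale a s).
Proof. by apply/tens_eqP; apply: fscale_rel; apply: tens_reprP. Qed.

Lemma fscale0 s : tens_rel (fscale 0 s) [::].
Proof.
elim: s => [|p s ih] /=; first exact: tens_refl.
rewrite scale0r; exact: (tens_cat (tens_zero _ _) ih).
Qed.

Lemma fscaleD a b s : tens_rel (fscale (a + b) s) (fscale a s ++ fscale b s).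
Proof.
elim: s => [|p s ih] /=; first exact: tens_refl.
rewrite scalerDl.
apply: (tens_trans (tens_cat (tens_add_l _ _ _) ih)).
apply: (@tens_cat _ _ _ [:: _] [:: _]); first exact: tens_refl.
rewrite -cat1s catA.
rewrite -[in X in tens_rel _ X]cat1s.
rewrite [X in tens_rel _ X]catA.
apply: tens_cat; [exact: tens_catC|exact: tens_refl].
Qed.

Lemma fscale1 s : fscale 1 s = s.
Proof.
by rewrite /fscale -[RHS]map_id; apply: eq_map => -[x y] /=; rewrite scale1r.
Qed.

Fact tens_addA : associative tens_add.
Proof.
move=> u v w; have [s ->] := tens_pi u; have [t ->] := tens_pi v; have [r ->] := tens_pi w.
by rewrite !pi_cat catA.
Qed.

Fact tens_addC : commutative tens_add.
Proof.
move=> u v; have [s ->] := tens_pi u; have [t ->] := tens_pi v; rewrite !pi_cat.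
by apply/tens_eqP; apply: tens_catC.
Qed.

Fact tens_add0 : left_id (\pi_tensor [::]) tens_add.
Proof. by move=> u; have [s ->] := tens_pi u; rewrite pi_cat. Qed.

Fact tens_addN : left_inverse (\pi_tensor [::]) tens_opp tens_add.
Proof.
move=> u; have [s ->] := tens_pi u; rewrite -[tens_opp _]/(tens_mul _ _) pi_fscale.
rewrite -[in X in tens_add _ X](fscale1 s) pi_cat; apply/tens_eqP.
by apply: tens_trans (tens_sym (fscaleD _ _ _)) _; rewrite addNr; apply: fscale0.
Qed.

HB.instance Definition _ :=
  GRing.isZmodule.Build tensor tens_addA tens_addC tens_add0 tens_addN.

Fact tens_mulA a b (u : tensor) :
  tens_mul a (tens_mul b u) = tens_mul (a * b) u.
Proof.
have [s ->] := tens_pi u; rewrite !pi_fscale /fscale -map_comp.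
by congr (\pi_tensor _); apply: eq_map => p /=; rewrite scalerA.
Qed.

Fact tens_mul1 : left_id 1 tens_mul.
Proof. by move=> u; have [s ->] := tens_pi u; rewrite pi_fscale fscale1. Qed.

Fact tens_mulDr : right_distributive tens_mul +%R.
Proof.
move=> a u v; have [s ->] := tens_pi u; have [t ->] := tens_pi v.
rewrite -[X in tens_mul _ X = _]/(tens_add _ _) -[RHS]/(tens_add _ _).
by rewrite pi_cat !pi_fscale pi_cat /fscale map_cat.
Qed.

Fact tens_mulDl (u : tensor) : {morph tens_mul^~ u : a b / a + b}.
Proof.
move=> a b; have [s ->] := tens_pi u.
rewrite /= !pi_fscale -[RHS]/(tens_add _ _) pi_cat; apply/tens_eqP.
exact: fscaleD.
Qed.

HB.instance Definition _ := GRing.Zmodule_isLmodule.Build K tensor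
  tens_mulA tens_mul1 tens_mulDr tens_mulDl.

Lemma pi_add s t : \pi_tensor s + \pi_tensor t = \pi_tensor (s ++ t).
Proof. exact: pi_cat. Qed.

Lemma pi_scale a s : a *: \pi_tensor s = \pi_tensor (fscale a s).
Proof. exact: pi_fscale. Qed.

Fact tens_bilinear :
  bilinear_for (GRing.Scale.Law.clone _ _ *:%R _)
               (GRing.Scale.Law.clone _ _ *:%R _) tens.
Proof.
split=> [y a x x'|x a y y'] /=; rewrite pi_scale pi_add; apply/tens_eqP.
- exact: tens_add_l.
- apply: (tens_trans (tens_add_r _ _ _)).
  apply: (@tens_cat _ _ _ [:: _] [:: _]); last exact: tens_refl.
  exact: tens_sym (tens_scale _ _ _).
Qed.

HB.instance Definition _ :=
  bilinear_isBilinear.Build K V W tensor _ _ tens tens_bilinear.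
HB.instance Definition _ (x : V) :=
  GRing.isLinear.Build K W tensor _ (tens x) (tens_bilinear.2 x).

Lemma tens_sum (u : tensor) : u = \sum_(p <- repr u) tens p.1 p.2.
Proof.
rewrite -[LHS]reprK; elim: (repr u) => [|[x y] s ih]; first by rewrite big_nil.
by rewrite big_cons -ih pi_add.
Qed.

(* The linear map on the tensor product induced by a bilinear map. *)
Section Lift.
Variables (U : lmodType K) (f : {bilinear V -> W -> U}).

Definition tlift (u : tensor) : U := \sum_(p <- repr u) f p.1 p.2.

Lemma tens_rel_lift s t : tens_rel s t ->
  \sum_(p <- s) f p.1 p.2 = \sum_(p <- t) f p.1 p.2.
Proof.
elim=> {s t} [s|s t _|s t u _ h1 _|s s' t t' _ h1 _ h2|s t|x x' y|x y y'|b x y|y] //.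
- by move=> <-.
- by rewrite !big_cat /= h1 h2.
- by rewrite !big_cat /= addrC.
- by rewrite !big_cons !big_nil !addr0 linearDl.
- by rewrite !big_cons !big_nil !addr0 linearDr.
- by rewrite !big_cons !big_nil !addr0 linearZl_LR linearZr_LR.
- by rewrite !big_cons !big_nil addr0 linear0l.
Qed.

Lemma tlift_pi s : tlift (\pi_tensor s) = \sum_(p <- s) f p.1 p.2.
Proof. by apply: tens_rel_lift; apply: tens_reprP. Qed.

Lemma tliftE x y : tlift (tens x y) = f x y.
Proof. by rewrite tlift_pi big_seq1. Qed.

Fact tlift_linear : linear tlift.
Proof.
move=> a u v; have [s ->] := tens_pi u; have [t ->] := tens_pi v.
rewrite pi_scale pi_add !tlift_pi big_cat /= big_map; congr (_ + _).
by rewrite scaler_sumr; apply: eq_bigr => p _; rewrite linearZl_LR.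
Qed.

HB.instance Definition _ := GRing.isLinear.Build K tensor U _ tlift tlift_linear.

End Lift.

Lemma tens_ext (U : lmodType K) (f g : {linear tensor -> U}) :
  (forall x y, f (tens x y) = g (tens x y)) -> f =1 g.
Proof.
by move=> h u; rewrite (tens_sum u) !linear_sum; apply: eq_bigr => p _; apply: h.
Qed.

End Tensor.

Arguments tensor {K} V W.
Arguments tens {K V W}.
Arguments tlift {K V W U}.

Notation "V ⨂ W" := (tensor V W) (at level 40, left associativity).
Notation "x ⊗ y" := (tens x y) (at level 40, left associativity) : ring_scope.

Section TensorMaps.
Variable K : fieldType.

Section Map.
Variables V V' W W' : lmodType K.
Variables (f : {linear V -> V'}) (g : {linear W -> W'}).

Definition tmap_fun (x : V) (y : W) : V' ⨂ W' := f x ⊗ g y.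

Fact tmap_bilinear :
  bilinear_for (GRing.Scale.Law.clone _ _ *:%R _)
               (GRing.Scale.Law.clone _ _ *:%R _) tmap_fun.
Proof.
by split=> [y a x x'|x a y y']; rewrite /tmap_fun linearP /= ?linearPl ?linearPr.
Qed.

HB.instance Definition _ :=
  bilinear_isBilinear.Build K V W (V' ⨂ W') _ _ tmap_fun tmap_bilinear.

Definition tmap : V ⨂ W -> V' ⨂ W' := tlift tmap_fun.
HB.instance Definition _ :=
  GRing.isLinear.Build K (V ⨂ W) (V' ⨂ W') _ tmap (tlift_linear _).

Lemma tmapE x y : tmap (x ⊗ y) = f x ⊗ g y.
Proof. exact: tliftE. Qed.

End Map.

Section Flip.
Variables V W : lmodType K.

Definition tflip_fun (x : V) (y : W) : W ⨂ V := y ⊗ x.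

Fact tflip_bilinear :
  bilinear_for (GRing.Scale.Law.clone _ _ *:%R _)
               (GRing.Scale.Law.clone _ _ *:%R _) tflip_fun.
Proof.
by split=> [y a x x'|x a y y']; rewrite /tflip_fun ?linearPl ?linearPr.
Qed.

HB.instance Definition _ :=
  bilinear_isBilinear.Build K V W (W ⨂ V) _ _ tflip_fun tflip_bilinear.

Definition tflip : V ⨂ W -> W ⨂ V := tlift tflip_fun.
HB.instance Definition _ :=
  GRing.isLinear.Build K (V ⨂ W) (W ⨂ V) _ tflip (tlift_linear _).

Lemma tflipE x y : tflip (x ⊗ y) = y ⊗ x.
Proof. exact: tliftE. Qed.

End Flip.
Arguments tflip : clear implicits.

Section Assoc.
Variables V W U : lmodType K.

Definition tassocl_fun (x : V) (t : W ⨂ U) : (V ⨂ W) ⨂ U :=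
  tmap (tens x) idfun t.

Fact tassocl_bilinear :
  bilinear_for (GRing.Scale.Law.clone _ _ *:%R _)
               (GRing.Scale.Law.clone _ _ *:%R _) tassocl_fun.
Proof.
split=> [t a x x'|x a t t']; last exact: linearP.
rewrite /tassocl_fun (tens_sum t) !linear_sum /= scaler_sumr -big_split /=.
by apply: eq_bigr => p _; rewrite !tmapE /= linearPl linearPl.
Qed.

HB.instance Definition _ :=
  bilinear_isBilinear.Build K V (W ⨂ U) ((V ⨂ W) ⨂ U) _ _
    tassocl_fun tassocl_bilinear.

Definition tassocl : V ⨂ (W ⨂ U) -> (V ⨂ W) ⨂ U := tlift tassocl_fun.
HB.instance Definition _ :=
  GRing.isLinear.Build K (V ⨂ (W ⨂ U)) ((V ⨂ W) ⨂ U) _ tassocl (tlift_linear _).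

Lemma tassoclE x y z : tassocl (x ⊗ (y ⊗ z)) = (x ⊗ y) ⊗ z.
Proof. by rewrite /tassocl /= tliftE /= /tassocl_fun tmapE. Qed.

End Assoc.
Arguments tassocl : clear implicits.

Section AssocR.
Variables V W U : lmodType K.

Definition tassocr : (V ⨂ W) ⨂ U -> V ⨂ (W ⨂ U) :=
  tmap idfun (tflip U W) \o (tflip (U ⨂ W) V) \o tassocl U W V
    \o tmap idfun (tflip V W) \o tflip (V ⨂ W) U.
HB.instance Definition _ := GRing.Linear.on tassocr.

Lemma tassocrE x y z : tassocr ((x ⊗ y) ⊗ z) = x ⊗ (y ⊗ z).
Proof. by rewrite /tassocr /= tflipE tmapE /= tflipE tassoclE tflipE tmapE /= tflipE. Qed.

End AssocR.
Arguments tassocr : clear implicits.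

End TensorMaps.

Arguments tmap {K V V' W W'} f g.
Arguments tflip {K} V W.
Arguments tassocl {K} V W U.
Arguments tassocr {K} V W U.

(* Triple tensor products are associated to the left, as in
   (Delta (x) id) Delta; [tassocl] and [tassocr] move between the two
   bracketings. *)
Section BiHom.
Variables (K : fieldType) (C : lmodType K).

Section Product.
Variable mu : {linear C ⨂ C -> C}.

Definition mul (a b : C) : C := mu (a ⊗ b).

Fact mul_bilinear :
  bilinear_for (GRing.Scale.Law.clone _ _ *:%R _)
               (GRing.Scale.Law.clone _ _ *:%R _) mul.
Proof.
by split=> [y a x x'|x a y y']; rewrite /mul ?linearPl ?linearPr linearP.
Qed.

Definition lmul (a b : C) : C := mul a b.
Definition rmul (b a : C) : C := mul a b.

HB.instance Definition _ (a : C) :=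
  GRing.isLinear.Build K C C _ (lmul a) (mul_bilinear.2 a).
HB.instance Definition _ (b : C) :=
  GRing.isLinear.Build K C C _ (rmul b) (mul_bilinear.1 b).

End Product.

Record is_BiHom_assoc_algebra
    (mu : {linear C ⨂ C -> C}) (alpha beta : {linear C -> C}) : Prop := {
  bihom_alg_comm : forall a, alpha (beta a) = beta (alpha a);
  bihom_alg_alphaM :
    forall a b, alpha (mul mu a b) = mul mu (alpha a) (alpha b);
  bihom_alg_betaM : forall a b, beta (mul mu a b) = mul mu (beta a) (beta b);
  bihom_alg_assoc : forall a b c,
    mul mu (alpha a) (mul mu b c) = mul mu (mul mu a b) (beta c)
}.

Record is_BiHom_coassoc_coalgebra
    (Delta : {linear C -> C ⨂ C}) (psi omega : {linear C -> C}) : Prop := {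
  bihom_coalg_comm : forall c, psi (omega c) = omega (psi c);
  bihom_coalg_psi : forall c, tmap psi psi (Delta c) = Delta (psi c);
  bihom_coalg_omega : forall c, tmap omega omega (Delta c) = Delta (omega c);
  bihom_coalg_coassoc : forall c,
    tmap Delta psi (Delta c) = tassocl C C C (tmap omega Delta (Delta c))
}.

Record is_infBH_bialgebra (lambda : K)
    (mu : {linear C ⨂ C -> C}) (Delta : {linear C -> C ⨂ C})
    (alpha beta psi omega : {linear C -> C}) : Prop := {
  infBH_alg : is_BiHom_assoc_algebra mu alpha beta;
  infBH_coalg : is_BiHom_coassoc_coalgebra Delta psi omega;
  infBH_alpha_psi : forall c, alpha (psi c) = psi (alpha c);
  infBH_alpha_omega : forall c, alpha (omega c) = omega (alpha c);
  infBH_beta_psi : forall c, beta (psi c) = psi (beta c);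
  infBH_beta_omega : forall c, beta (omega c) = omega (beta c);
  infBH_Delta_alpha : forall c, tmap alpha alpha (Delta c) = Delta (alpha c);
  infBH_Delta_beta : forall c, tmap beta beta (Delta c) = Delta (beta c);
  infBH_psiM : forall a b, psi (mul mu a b) = mul mu (psi a) (psi b);
  infBH_omegaM : forall a b, omega (mul mu a b) = mul mu (omega a) (omega b);
  infBH_compat : forall a b,
    Delta (mul mu a b) =
      tmap (lmul mu (omega a)) beta (Delta b)
      + tmap alpha (rmul mu (psi b)) (Delta a)
      + lambda *: (alpha (omega a) ⊗ beta (psi b))
}.

Definition delta_bar (delta : {linear C -> C ⨂ C})
    (psi omega : {linear C -> C}) (c : C) : C ⨂ C ⨂ C :=
  tassocl C C C
    (tmap (omega \o psi) (tmap omega idfun \o delta) (delta c))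
  - tmap (tmap psi omega \o delta) psi (delta c).

Definition Phi12 : C ⨂ C ⨂ C -> C ⨂ C ⨂ C := tmap (tflip C C) idfun.

Record is_BiHom_preLie_coalgebra
    (delta : {linear C -> C ⨂ C}) (psi omega : {linear C -> C}) : Prop := {
  preLie_comm : forall c, psi (omega c) = omega (psi c);
  preLie_psi : forall c, delta (psi c) = tmap psi psi (delta c);
  preLie_omega : forall c, delta (omega c) = tmap omega omega (delta c);
  preLie_eq : forall c,
    delta_bar delta psi omega c - Phi12 (delta_bar delta psi omega c) = 0
}.

(* The operation on C (x) C (x) C underlying Delta_star; see [star_mapE]. *)
Definition star_map (mu : {linear C ⨂ C -> C})
    (alpha beta psi omega : {linear C -> C}) : C ⨂ C ⨂ C -> C ⨂ C :=
  tmap omega (mu \o tmap (beta \o psi \o psi) (alpha \o psi \o omega \o omega))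
    \o tassocr C C C \o tmap (tflip C C) idfun.

HB.instance Definition _ mu alpha beta psi omega :=
  GRing.Linear.on (star_map mu alpha beta psi omega).

Lemma star_mapE mu alpha beta psi omega x y z :
  star_map mu alpha beta psi omega (x ⊗ y ⊗ z) =
    omega y ⊗ mul mu (beta (psi (psi x))) (alpha (psi (omega (omega z)))).
Proof. by rewrite /star_map /= !tmapE /= tflipE tassocrE tmapE /= tmapE. Qed.

Definition Delta_star
    (mu : {linear C ⨂ C -> C}) (Delta : {linear C -> C ⨂ C})
    (alpha beta psi omega : {linear C -> C}) : C -> C ⨂ C :=
  star_map mu alpha beta psi omega \o tmap Delta idfun \o Delta.
HB.instance Definition _ mu Delta alpha beta psi omega :=
  GRing.Linear.on (Delta_star mu Delta alpha beta psi omega).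

End BiHom.

(* Main.v *)
(* The compatibility of Delta with the product, used twice, expands Delta_star
   of a product into five summands.  Without the twisting maps, and writing
   a (x) b (x) d (x) e (x) g (or a (x) b (x) d (x) e) for the iterated coproduct
   of c, the first term of delta_bar c is therefore
     b (x) e (x) (a d) g  +  d (x) b e (x) a g  +  lambda b (x) d (x) a e
     +  e (x) b (x) a (d g)  +  lambda d (x) b (x) a e .
   The second summand cancels the subtracted term of delta_bar c, while the flip
   of the first two factors exchanges the first with the fourth (by
   associativity) and the third with the fifth.  BiHom-coassociativity shows
   that the twisting maps match. *)
Require Import Defs.
From HB Require Import structures.
From mathcomp Require Import all_boot all_algebra.
From mathcomp Require Import boolp.
Import GRing.Theory.
Local Open Scope ring_scope.

(** * Sweedler sums and multilinear functions *)

Section SweedlerSums.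
Context {K : fieldType}.

(* For bilinear [f], [tsum (Delta c) f] is [f c_1 c_2] in Sweedler notation. *)
Definition tsum {V W U : lmodType K} (t : V ⨂ W) (f : V -> W -> U) : U :=
  \sum_(p <- repr t) f p.1 p.2.

(** Multilinearity is kept as a predicate, not a bundled structure, so that it can be checked on
    bare function expressions in several Sweedler variables. *)
Definition bilin {V W U : lmodType K} (f : V -> W -> U) : Prop :=
  (forall y, linear (f^~ y)) /\ (forall x, linear (f x)).

Definition trilin {V W X U : lmodType K} (f : V -> W -> X -> U) : Prop :=
  [/\ forall y z, linear (fun x => f x y z), forall x z, linear (fun y => f x y z)
    & forall x y, linear (f x y)].

Definition quadlin {V U : lmodType K} (f : V -> V -> V -> V -> U) : Prop :=
  [/\ forall b c d, linear (fun a => f a b c d),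
      forall a c d, linear (fun b => f a b c d),
      forall a b d, linear (fun c => f a b c d)
    & forall a b c, linear (fun d => f a b c d)].

Definition quintlin {V U : lmodType K} (f : V -> V -> V -> V -> V -> U) : Prop :=
  [/\ forall b c d e, linear (fun a => f a b c d e),
      forall a c d e, linear (fun b => f a b c d e),
      forall a b d e, linear (fun c => f a b c d e),
      forall a b c e, linear (fun d => f a b c d e)
    & forall a b c d, linear (fun e => f a b c d e)].

Section Bilinear.
Context {V W U : lmodType K}.
Implicit Types (t : V ⨂ W) (f : V -> W -> U).

(** [tsum] runs over a chosen representative of the tensor. For bilinear [f] it coincides with the
    map given by the universal property, hence is linear in the tensor. *)
Lemma bilin_lift f : bilin f ->
  exists F : {linear V ⨂ W -> U}, (forall x y, F (x ⊗ y) = f x y) /\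
    (forall t, F t = tsum t f).
Proof.
move=> [fl fr].
have fB : bilinear_for (GRing.Scale.Law.clone _ _ *:%R _)
               (GRing.Scale.Law.clone _ _ *:%R _) f by split.
pose B : {bilinear V -> W -> U} :=
  HB.pack f (bilinear_isBilinear.Build K V W U _ _ f fB).
by exists (tlift B); split=> [x y|//]; apply: tliftE.
Qed.

Lemma tsum_tens f x y : bilin f -> tsum (x ⊗ y) f = f x y.
Proof. by move=> /bilin_lift[F [FE <-]]; rewrite FE. Qed.

Lemma tsumD f t u : bilin f -> tsum (t + u) f = tsum t f + tsum u f.
Proof. by move=> /bilin_lift[F [_ FE]]; rewrite -!FE linearD. Qed.

Lemma tsumZ f a t : bilin f -> tsum (a *: t) f = a *: tsum t f.
Proof. by move=> /bilin_lift[F [_ FE]]; rewrite -!FE linearZ. Qed.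

(** From here to [linear_tsum] the tensor is fixed: these are identities of finite sums over one
    representative, valid for arbitrary [f]. *)
Lemma eq_tsum f g t : (forall x y, f x y = g x y) -> tsum t f = tsum t g.
Proof. by move=> fg; apply: eq_bigr. Qed.

Lemma tsum_add f g t : tsum t (fun x y => f x y + g x y) = tsum t f + tsum t g.
Proof. exact: big_split. Qed.

Lemma scale_tsum a f t : a *: tsum t f = tsum t (fun x y => a *: f x y).
Proof. exact: scaler_sumr. Qed.

Lemma linear_tsum (X : lmodType K) (L : {linear U -> X}) f t :
  L (tsum t f) = tsum t (fun x y => L (f x y)).
Proof. exact: linear_sum. Qed.

Lemma tsum_repr t : t = tsum t tens.
Proof. exact: tens_sum. Qed.

End Bilinear.

Lemma exchange_tsum {V W V' W' U : lmodType K} (t : V ⨂ W) (u : V' ⨂ W')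
    (f : V -> W -> V' -> W' -> U) :
  tsum t (fun x y => tsum u (f x y)) =
  tsum u (fun x' y' => tsum t (fun x y => f x y x' y')).
Proof. exact: exchange_big. Qed.

Lemma linear_fun_id {V : lmodType K} : linear (fun x : V => x).
Proof. by []. Qed.

Lemma linear_tensl {V W U : lmodType K} {f : V -> W} (y : U) :
  linear f -> linear (fun x => f x ⊗ y).
Proof. by move=> fL a u v; rewrite fL linearPl. Qed.

Lemma linear_tensr {V W U : lmodType K} {f : V -> W} (y : U) :
  linear f -> linear (fun x => y ⊗ f x).
Proof. by move=> fL a u v; rewrite fL linearPr. Qed.

(** The variable of a Sweedler sum may sit in the summand, as here, or in the tensor, as in
    [linear_tsum_tensor]; only the latter calls on bilinearity of the summand. *)
Lemma linear_tsum_body {V W X U : lmodType K} (t : V ⨂ W) {f : X -> V -> W -> U} :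
  (forall y z, linear (fun x => f x y z)) -> linear (fun x => tsum t (f x)).
Proof.
move=> fL a u v; rewrite /tsum scaler_sumr -big_split /=.
by apply: eq_bigr => p _; rewrite fL.
Qed.

Lemma linear_tsum_tensor {V W X U : lmodType K} {t : X -> V ⨂ W} {f : V -> W -> U} :
  bilin f -> linear t -> linear (fun x => tsum (t x) f).
Proof. by move=> fB tL a u v; rewrite tL tsumD // tsumZ. Qed.

Lemma linear_compose {V W U : lmodType K} {g : W -> U} {f : V -> W} :
  linear g -> linear f -> linear (fun x => g (f x)).
Proof. by move=> gL fL a u v; rewrite fL gL. Qed.

(* Unqualified, [mul] is the product of fractions from [all_algebra]. *)
Lemma linear_mull {V C : lmodType K} (mu : {linear C ⨂ C -> C}) {f : V -> C} y :
  linear f -> linear (fun x => Defs.mul mu (f x) y).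
Proof. by move=> fL a u v; rewrite fL (Defs.mul_bilinear mu).1. Qed.

Lemma linear_mulr {V C : lmodType K} (mu : {linear C ⨂ C -> C}) {f : V -> C} y :
  linear f -> linear (fun x => Defs.mul mu y (f x)).
Proof. by move=> fL a u v; rewrite fL (Defs.mul_bilinear mu).2. Qed.

End SweedlerSums.

(* Proves multilinearity by recursion on the body of the function. *)
Ltac lin :=
  cbv beta;
  lazymatch goal with
  | |- bilin _ => split; intro; lin
  | |- trilin _ => split; do 2 intro; lin
  | |- quadlin _ => split; do 3 intro; lin
  | |- quintlin _ => split; do 4 intro; lin
  | |- forall _, _ => intro; lin
  | |- linear (fun x => x) => exact linear_fun_id
  | |- linear (fun _ => _ ⊗ ?y) => apply: (linear_tensl y); lin
  | |- linear (fun _ => ?y ⊗ _) => apply: (linear_tensr y); lin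
  | |- linear (fun _ => Defs.mul ?m _ ?y) => apply: (linear_mull m y); lin
  | |- linear (fun _ => Defs.mul ?m ?y _) => apply: (linear_mulr m y); lin
  | |- linear (fun _ => tsum ?t _) =>
      lazymatch goal with |- linear (fun x => tsum _ (@?f x)) =>
        refine (@linear_tsum_body _ _ _ _ _ t f _); lin end
  | |- linear (fun _ => tsum _ ?f) => apply: (@linear_tsum_tensor _ _ _ _ _ _ f); lin
  | H : bilin ?G |- linear (fun _ => ?G _ ?a1) =>
      apply: (@linear_compose _ _ _ _ (fun x => G x a1)); [by case: H|lin]
  | H : bilin ?G |- linear (fun _ => ?G ?a0 _) =>
      apply: (@linear_compose _ _ _ _ (fun x => G a0 x)); [by case: H|lin]
  | H : trilin ?G |- linear (fun _ => ?G _ ?a1 ?a2) =>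
      apply: (@linear_compose _ _ _ _ (fun x => G x a1 a2)); [by case: H|lin]
  | H : trilin ?G |- linear (fun _ => ?G ?a0 _ ?a2) =>
      apply: (@linear_compose _ _ _ _ (fun x => G a0 x a2)); [by case: H|lin]
  | H : trilin ?G |- linear (fun _ => ?G ?a0 ?a1 _) =>
      apply: (@linear_compose _ _ _ _ (fun x => G a0 a1 x)); [by case: H|lin]
  | H : quadlin ?G |- linear (fun _ => ?G _ ?a1 ?a2 ?a3) =>
      apply: (@linear_compose _ _ _ _ (fun x => G x a1 a2 a3)); [by case: H|lin]
  | H : quadlin ?G |- linear (fun _ => ?G ?a0 _ ?a2 ?a3) =>
      apply: (@linear_compose _ _ _ _ (fun x => G a0 x a2 a3)); [by case: H|lin]
  | H : quadlin ?G |- linear (fun _ => ?G ?a0 ?a1 _ ?a3) =>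
      apply: (@linear_compose _ _ _ _ (fun x => G a0 a1 x a3)); [by case: H|lin]
  | H : quadlin ?G |- linear (fun _ => ?G ?a0 ?a1 ?a2 _) =>
      apply: (@linear_compose _ _ _ _ (fun x => G a0 a1 a2 x)); [by case: H|lin]
  | H : quintlin ?G |- linear (fun _ => ?G _ ?a1 ?a2 ?a3 ?a4) =>
      apply: (@linear_compose _ _ _ _ (fun x => G x a1 a2 a3 a4)); [by case: H|lin]
  | H : quintlin ?G |- linear (fun _ => ?G ?a0 _ ?a2 ?a3 ?a4) =>
      apply: (@linear_compose _ _ _ _ (fun x => G a0 x a2 a3 a4)); [by case: H|lin]
  | H : quintlin ?G |- linear (fun _ => ?G ?a0 ?a1 _ ?a3 ?a4) =>
      apply: (@linear_compose _ _ _ _ (fun x => G a0 a1 x a3 a4)); [by case: H|lin]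
  | H : quintlin ?G |- linear (fun _ => ?G ?a0 ?a1 ?a2 _ ?a4) =>
      apply: (@linear_compose _ _ _ _ (fun x => G a0 a1 a2 x a4)); [by case: H|lin]
  | H : quintlin ?G |- linear (fun _ => ?G ?a0 ?a1 ?a2 ?a3 _) =>
      apply: (@linear_compose _ _ _ _ (fun x => G a0 a1 a2 a3 x)); [by case: H|lin]
  | |- linear (fun _ => Delta_star ?m ?D ?a ?b ?p ?o _) =>
      apply: (@linear_compose _ _ _ _ (Delta_star m D a b p o)); [exact: linearP|lin]
  | |- linear (fun _ => GRing.Linear.sort ?L _) =>
      apply: (@linear_compose _ _ _ _ L); [exact: linearP|lin]
  | |- linear _ => exact: linearP
  end.

(** * Sums over tensors that are themselves given as sums *)

Section SumsOfTensors.
Context {K : fieldType}.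

(** The representative of a sum of tensors is unrelated to those of the summands; the linear map
    induced by [f] bridges the two. *)
Lemma tsum_tsum {V W V' W' U : lmodType K} (t : V ⨂ W) (k : V -> W -> V' ⨂ W')
    (f : V' -> W' -> U) : bilin f ->
  tsum (tsum t k) f = tsum t (fun x y => tsum (k x y) f).
Proof.
move=> /bilin_lift[F [_ FE]]; rewrite -FE linear_tsum.
by apply: eq_tsum => x y; rewrite FE.
Qed.

Lemma tsum_tensl {V W U X : lmodType K} (t : V ⨂ W) (f : V -> W -> U) (y : X) :
  tsum t f ⊗ y = tsum t (fun v w => f v w ⊗ y).
Proof.
pose F : {linear U -> U ⨂ X} := HB.pack (fun u : U => u ⊗ y)
  (GRing.isLinear.Build K U (U ⨂ X) _ (fun u => u ⊗ y)
    (linear_tensl y linear_fun_id)).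
exact: (linear_tsum _ F f t).
Qed.

Lemma tmap_tsum {V W V' W' : lmodType K} (g : {linear V -> V'})
    (h : {linear W -> W'}) (t : V ⨂ W) :
  tmap g h t = tsum t (fun x y => g x ⊗ h y).
Proof. by rewrite {1}[t]tsum_repr linear_tsum; apply: eq_tsum => x y; apply: tmapE. Qed.

Lemma tsum_tmap {V W V' W' U : lmodType K} (g : {linear V -> V'})
    (h : {linear W -> W'}) (t : V ⨂ W) (f : V' -> W' -> U) : bilin f ->
  tsum (tmap g h t) f = tsum t (fun x y => f (g x) (h y)).
Proof.
move=> fB; rewrite tmap_tsum tsum_tsum //.
by apply: eq_tsum => x y; rewrite tsum_tens.
Qed.

End SumsOfTensors.

(** * Iterated coproducts and BiHom-coassociativity *)

Section InfBH.
Context {K : fieldType} {lambda : K} {C : lmodType K}.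
Context {mu : {linear C ⨂ C -> C}} {Delta : {linear C -> C ⨂ C}}.
Context {alpha beta psi omega : {linear C -> C}}.
Context (hC : is_infBH_bialgebra lambda mu Delta alpha beta psi omega).

Local Notation "a ∗ b" := (Defs.mul mu a b) (at level 40, left associativity).
Local Notation Ds := (Delta_star mu Delta alpha beta psi omega).


Let alg := infBH_alg hC.
Let coalg := infBH_coalg hC.

Lemma Delta_alpha_sum {U : lmodType K} (f : C -> C -> U) c : bilin f ->
  tsum (Delta (alpha c)) f = tsum (Delta c) (fun x y => f (alpha x) (alpha y)).
Proof. by move=> fB; rewrite -(infBH_Delta_alpha hC) tsum_tmap. Qed.

Lemma Delta_beta_sum {U : lmodType K} (f : C -> C -> U) c : bilin f ->
  tsum (Delta (beta c)) f = tsum (Delta c) (fun x y => f (beta x) (beta y)).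
Proof. by move=> fB; rewrite -(infBH_Delta_beta hC) tsum_tmap. Qed.

Lemma Delta_psi_sum {U : lmodType K} (f : C -> C -> U) c : bilin f ->
  tsum (Delta (psi c)) f = tsum (Delta c) (fun x y => f (psi x) (psi y)).
Proof. by move=> fB; rewrite -(bihom_coalg_psi coalg) tsum_tmap. Qed.

Lemma Delta_omega_sum {U : lmodType K} (f : C -> C -> U) c : bilin f ->
  tsum (Delta (omega c)) f = tsum (Delta c) (fun x y => f (omega x) (omega y)).
Proof. by move=> fB; rewrite -(bihom_coalg_omega coalg) tsum_tmap. Qed.

Lemma coassoc_sum {U : lmodType K} (f : C -> C -> C -> U) c : trilin f ->
  tsum (Delta c) (fun a b => tsum (Delta a) (fun a1 a2 => f a1 a2 (psi b))) =
  tsum (Delta c) (fun a b => tsum (Delta b) (fun b1 b2 => f (omega a) b1 b2)).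
Proof.
move=> fT.
have fB z : bilin (fun x y => f x y z) by lin.
(* [g] is [f] read as a bilinear function on pairs of a 2-tensor and a vector, so that both sides
   are its values on the two sides of coassociativity. *)
pose g (t : C ⨂ C) z := tsum t (fun x y => f x y z).
have gB : bilin g.
  by rewrite /g; lin.
transitivity (tsum (tmap Delta psi (Delta c)) g); first by rewrite tsum_tmap.
rewrite (bihom_coalg_coassoc coalg) tmap_tsum linear_tsum tsum_tsum //.
apply: eq_tsum => a b; rewrite [X in _ ⊗ X]tsum_repr !linear_tsum tsum_tsum //.
by apply: eq_tsum => b1 b2; rewrite /= tassoclE tsum_tens // /g tsum_tens.
Qed.

(** Coassociativity applied with the first of three factors split once more; [omega] then passes
    through that last coproduct. *)
Lemma coassoc_sum4 {U : lmodType K} (f : C -> C -> C -> C -> U) c : quadlin f ->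
  tsum (Delta c) (fun a b => tsum (Delta a) (fun a1 a2 =>
    tsum (Delta b) (fun b1 b2 => f (omega a1) (omega a2) b1 b2))) =
  tsum (Delta c) (fun a b => tsum (Delta a) (fun a1 a2 =>
    tsum (Delta a1) (fun p q => f p q a2 (psi b)))).
Proof.
move=> fQ.
rewrite (@coassoc_sum _ (fun x y z => tsum (Delta x) (fun p q => f p q y z)));
  last lin.
apply: eq_tsum => a b; rewrite exchange_tsum; apply: eq_tsum => b1 b2.
by rewrite Delta_omega_sum //; lin.
Qed.

(** [coassoc_sum4] is used twice, for [c] and then for its first factor, and leads to the coproduct
    that always splits the leftmost factor. *)
Lemma coassoc_sum5 {U : lmodType K} (f : C -> C -> C -> C -> C -> U) c :
  quintlin f ->
  tsum (Delta c) (fun a b => tsum (Delta a) (fun a1 a2 =>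
    tsum (Delta b) (fun b1 b2 => tsum (Delta b1) (fun p q =>
      f (omega (omega a1)) (omega (omega a2)) p q b2)))) =
  tsum (Delta c) (fun a b => tsum (Delta a) (fun a1 a2 =>
    tsum (Delta a1) (fun p q => tsum (Delta p) (fun r s =>
      f r s q (psi a2) (psi b))))).
Proof.
move=> fQ.
rewrite (@coassoc_sum4 _ (fun x y z w =>
  tsum (Delta z) (fun p q => f (omega x) (omega y) p q w))); last lin.
apply: eq_tsum => a b.
by rewrite -(@coassoc_sum4 _ (fun x y z w => f x y z w (psi b))); last lin.
Qed.

(** The right side is the splitting pattern produced by [Delta_star] applied to its own first
    factor. Coassociativity is used three times: inside [a], at [c], and inside the new [a]. *)
Lemma coassoc_sum5_mid {U : lmodType K} (f : C -> C -> C -> C -> C -> U) c :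
  quintlin f ->
  tsum (Delta c) (fun a b => tsum (Delta a) (fun a1 a2 =>
    tsum (Delta a1) (fun p q => tsum (Delta b) (fun b1 b2 =>
      f p (omega q) (omega (psi a2)) (psi b1) b2)))) =
  tsum (Delta c) (fun a b => tsum (Delta a) (fun a1 a2 =>
    tsum (Delta a2) (fun x y => tsum (Delta x) (fun p q =>
      f (omega a1) p q y (psi b))))).
Proof.
move=> fQ.
transitivity (tsum (Delta c) (fun a b => tsum (Delta b) (fun b1 b2 =>
    tsum (Delta (omega a)) (fun a1 a2 => tsum (Delta a2) (fun s t =>
      f a1 s t (psi b1) b2))))).
  apply: eq_tsum => a b.
  (* With the sum over [b] hidden in [k], only the three factors coming from [a] remain to be
     reassociated. *)
  pose k p q r := tsum (Delta b) (fun b1 b2 => f p q r (psi b1) b2).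
  have kT : trilin k by rewrite /k; lin.
  rewrite exchange_tsum Delta_omega_sum; last lin.
  rewrite (@coassoc_sum _ (fun p q r => k p (omega q) (omega r))); last lin.
  apply: eq_tsum => a1 a2; rewrite exchange_tsum Delta_omega_sum //.
  by rewrite /k; lin.
rewrite -(@coassoc_sum _ (fun u v w =>
  tsum (Delta u) (fun a1 a2 => tsum (Delta a2) (fun s t =>
    f a1 s t (psi v) w)))); last lin.
apply: eq_tsum => a b.
by rewrite -(@coassoc_sum _ (fun u x y =>
  tsum (Delta x) (fun p q => f u p q y (psi b)))); last lin.
Qed.

(** * [Delta_star] on a product *)

Lemma Delta_mul_sum {U : lmodType K} (f : C -> C -> U) x y : bilin f ->
  tsum (Delta (x ∗ y)) f =
  tsum (Delta y) (fun y1 y2 => f (omega x ∗ y1) (beta y2))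
  + tsum (Delta x) (fun x1 x2 => f (alpha x1) (x2 ∗ psi y))
  + lambda *: f (alpha (omega x)) (beta (psi y)).
Proof.
move=> fB; rewrite (infBH_compat hC) !tsumD // !tsum_tmap // tsumZ //.
by rewrite tsum_tens.
Qed.

Lemma Delta_starE c :
  Ds c = tsum (Delta c) (fun a b => tsum (Delta a) (fun a1 a2 =>
    omega a2 ⊗ (beta (psi (psi a1)) ∗ alpha (psi (omega (omega b)))))).
Proof.
rewrite /Delta_star /= tmap_tsum linear_tsum; apply: eq_tsum => a b /=.
rewrite {1}[Delta a]tsum_repr tsum_tensl linear_tsum.
by apply: eq_tsum => a1 a2; apply: star_mapE.
Qed.

Lemma Delta_star_sum {U : lmodType K} (f : C -> C -> U) c : bilin f ->
  tsum (Ds c) f =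
  tsum (Delta c) (fun a b => tsum (Delta a) (fun a1 a2 =>
    f (omega a2) (beta (psi (psi a1)) ∗ alpha (psi (omega (omega b)))))).
Proof.
move=> fB; rewrite Delta_starE tsum_tsum //; apply: eq_tsum => a b.
by rewrite tsum_tsum //; apply: eq_tsum => a1 a2; rewrite tsum_tens.
Qed.

Lemma beta_alpha x : beta (alpha x) = alpha (beta x).
Proof. by rewrite (bihom_alg_comm alg). Qed.

Lemma omega_psi x : omega (psi x) = psi (omega x).
Proof. by rewrite (bihom_coalg_comm coalg). Qed.

(** Rewriting to a normal form: twisting maps are distributed over products and ordered from outside
    to inside as [alpha], [beta], [psi], [omega]. *)
Let twistE := (bihom_alg_alphaM alg, bihom_alg_betaM alg, infBH_psiM hC,
  infBH_omegaM hC, beta_alpha, omega_psi, fun x => esym (infBH_alpha_psi hC x),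
  fun x => esym (infBH_alpha_omega hC x), fun x => esym (infBH_beta_psi hC x),
  fun x => esym (infBH_beta_omega hC x)).

Local Ltac twist_sums := do ?[apply: eq_tsum => ? ?]; rewrite ?twistE.

Local Notation psi2 x := (psi (psi x)).
Local Notation psi3 x := (psi (psi2 x)).
Local Notation psi4 x := (psi (psi3 x)).
Local Notation omega2 x := (omega (omega x)).
Local Notation omega3 x := (omega (omega2 x)).
Local Notation omega4 x := (omega (omega3 x)).
Local Notation omega5 x := (omega (omega4 x)).

Lemma Delta_star_mul_sum {U : lmodType K} (f : C -> C -> U) x y : bilin f ->
  tsum (Ds (x ∗ y)) f =
  tsum (Delta y) (fun y1 y2 => tsum (Delta y1) (fun p q =>
      f (beta (omega q))
        ((beta (psi2 (omega2 x)) ∗ beta (psi2 p)) ∗ alpha (beta (psi (omega2 y2))))))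
  + tsum (Delta x) (fun x1 x2 => tsum (Delta y) (fun y1 y2 =>
      f (omega2 x2 ∗ psi (omega y1))
        (alpha (beta (psi2 (omega x1))) ∗ alpha (beta (psi (omega2 y2))))))
  + lambda *: tsum (Delta y) (fun y1 y2 =>
      f (beta (psi (omega y1)))
        (alpha (beta (psi2 (omega2 x))) ∗ alpha (beta (psi (omega2 y2)))))
  + tsum (Delta x) (fun x1 x2 => tsum (Delta x1) (fun p q =>
      f (alpha (omega q))
        (alpha (beta (psi2 p)) ∗ (alpha (psi (omega2 x2)) ∗ alpha (psi2 (omega2 y))))))
  + lambda *: tsum (Delta x) (fun x1 x2 =>
      f (alpha (omega2 x2))
        (alpha (beta (psi2 (omega x1))) ∗ alpha (beta (psi2 (omega2 y))))).
Proof.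
move=> fB; rewrite Delta_star_sum // Delta_mul_sum; last lin.
congr (_ + _ + _).
(* The first leg [omega x ∗ y1] is again a product, so this term of the coproduct gives three
   summands; the other two give one each. *)
- rewrite [X in _ + X + _]exchange_tsum scale_tsum -!tsum_add.
  apply: eq_tsum => y1 y2; rewrite Delta_mul_sum; last lin.
  rewrite Delta_omega_sum; last lin.
  by congr (_ + _ + _ *: _); twist_sums.
- apply: eq_tsum => x1 x2; rewrite Delta_alpha_sum; last lin.
  by twist_sums.
- congr (_ *: _); rewrite Delta_alpha_sum; last lin.
  rewrite Delta_omega_sum; last lin.
  by twist_sums.
Qed.

(** * [Delta_star] applied twice *)

Lemma Delta_beta_psi2_sum {U : lmodType K} (f : C -> C -> U) c : bilin f ->
  tsum (Delta (beta (psi2 c))) f =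
  tsum (Delta c) (fun x y => f (beta (psi2 x)) (beta (psi2 y))).
Proof. by move=> fB; rewrite Delta_beta_sum // !Delta_psi_sum //; lin. Qed.

Lemma Delta_alpha_psi_omega2_sum {U : lmodType K} (f : C -> C -> U) c : bilin f ->
  tsum (Delta (alpha (psi (omega2 c)))) f =
  tsum (Delta c) (fun x y => f (alpha (psi (omega2 x))) (alpha (psi (omega2 y)))).
Proof.
by move=> fB; rewrite Delta_alpha_sum // Delta_psi_sum ?Delta_omega_sum //; lin.
Qed.

(** The twisted form of [b ⊗ e ⊗ (a d) g]. A general [G] replaces the triple tensor, so that the
    flip becomes an exchange of the arguments of [G]. *)
Definition nested_term {U : lmodType K} (G : C -> C -> C -> U) c : U :=
  tsum (Delta c) (fun a b => tsum (Delta a) (fun a1 a2 =>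
  tsum (Delta b) (fun b1 b2 => tsum (Delta b1) (fun p q =>
    G (alpha (beta (psi3 (omega5 a2)))) (alpha (beta (psi2 (omega5 q))))
      ((beta (beta (psi4 (omega2 a1))) ∗ alpha (beta (psi3 (omega2 p)))) ∗
       alpha (alpha (beta (psi2 (omega4 b2))))))))).

(** The twisted form of [b ⊗ d ⊗ a e], without its coefficient [lambda]. *)
Definition weight_term {U : lmodType K} (G : C -> C -> C -> U) c : U :=
  tsum (Delta c) (fun a b => tsum (Delta a) (fun a1 a2 =>
  tsum (Delta b) (fun b1 b2 =>
    G (alpha (beta (psi3 (omega5 a2)))) (alpha (beta (psi3 (omega5 b1))))
      (alpha (beta (beta (psi4 (omega2 a1)))) ∗
       alpha (alpha (beta (psi2 (omega4 b2)))))))).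

Definition swap12 {U : Type} (G : C -> C -> C -> U) x y z := G y x z.

(** The right side is the fourth summand [e ⊗ b ⊗ a (d g)] as it arises in [star_right_sum].
    [coassoc_sum5] matches the splittings, BiHom-associativity the bracketings. *)
Lemma nested_term_swap {U : lmodType K} (G : C -> C -> C -> U) c : trilin G ->
  nested_term (swap12 G) c =
  tsum (Delta c) (fun a b => tsum (Delta a) (fun a1 a2 =>
  tsum (Delta a1) (fun p q => tsum (Delta p) (fun r s =>
    G (alpha (beta (psi3 (omega5 a2)))) (alpha (beta (psi3 (omega3 s))))
      (alpha (beta (beta (psi4 r))) ∗
       (alpha (beta (psi3 (omega2 q))) ∗ alpha (alpha (psi3 (omega4 b))))))))).
Proof.
(* In [f] the last two arguments carry one [psi] less than on the right side, since [coassoc_sum5]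
   supplies it. *)
move=> GT; pose f r s q t b :=
  G (alpha (beta (psi2 (omega5 t)))) (alpha (beta (psi3 (omega3 s))))
    (alpha (beta (beta (psi4 r))) ∗
     (alpha (beta (psi3 (omega2 q))) ∗ alpha (alpha (psi2 (omega4 b))))).
have fQ : quintlin f by rewrite /f; lin.
apply: etrans (etrans (coassoc_sum5 f c fQ) _); rewrite /f /swap12.
  by twist_sums; rewrite (bihom_alg_assoc alg) !twistE.
by twist_sums.
Qed.

(** Likewise for the fifth summand [d ⊗ b ⊗ a e], through [coassoc_sum4]. *)
Lemma weight_term_swap {U : lmodType K} (G : C -> C -> C -> U) c : trilin G ->
  weight_term (swap12 G) c =
  tsum (Delta c) (fun a b => tsum (Delta a) (fun a1 a2 =>
  tsum (Delta a1) (fun p q =>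
    G (alpha (beta (psi3 (omega5 a2)))) (alpha (beta (psi3 (omega4 q))))
      (alpha (beta (beta (psi4 (omega p)))) ∗
       alpha (alpha (beta (psi3 (omega4 b)))))))).
Proof.
move=> GT; pose f p q a b :=
  G (alpha (beta (psi3 (omega5 a)))) (alpha (beta (psi3 (omega4 q))))
    (alpha (beta (beta (psi4 (omega p)))) ∗ alpha (alpha (beta (psi2 (omega4 b))))).
have fQ : quadlin f by rewrite /f; lin.
by apply: etrans (etrans (coassoc_sum4 f c fQ) _); rewrite /f /swap12; twist_sums.
Qed.

Local Notation psi' := (alpha \o beta \o psi \o psi \o omega \o omega).
Local Notation omega' := (psi \o omega \o omega).

(** This rewrites the subtracted term of [delta_bar] as the second summand [d ⊗ b e ⊗ a g], with
    splittings matched by [coassoc_sum5_mid] read from right to left. *)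
Lemma star_left_sum {U : lmodType K} (G : C -> C -> C -> U) c : trilin G ->
  tsum (Ds c) (fun x y => tsum (Ds x) (fun x1 x2 =>
    G (psi' x1) (omega' x2) (psi' y))) =
  tsum (Delta c) (fun a b => tsum (Delta a) (fun a1 a2 =>
  tsum (Delta a1) (fun p q => tsum (Delta b) (fun b1 b2 =>
    G (alpha (beta (psi3 (omega5 a2))))
      (beta (psi3 (omega4 q)) ∗ alpha (psi3 (omega5 b1)))
      (alpha (beta (beta (psi4 (omega p)))) ∗
       alpha (alpha (beta (psi2 (omega4 b2))))))))).
Proof.
move=> GT; rewrite Delta_star_sum /=; last lin.
pose f u p q y b :=
  G (alpha (beta (psi2 (omega4 q)))) (beta (psi3 (omega3 p)) ∗ alpha (psi2 (omega5 y)))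
    (alpha (beta (beta (psi4 (omega u)))) ∗ alpha (alpha (beta (psi2 (omega4 b))))).
have fQ : quintlin f by rewrite /f; lin.
apply: etrans (etrans (esym (coassoc_sum5_mid f c fQ)) _); rewrite /f; last by twist_sums.
apply: eq_tsum => a b; apply: eq_tsum => a1 a2.
rewrite Delta_star_sum; last lin.
rewrite Delta_omega_sum; last lin.
apply: eq_tsum => x y; rewrite Delta_omega_sum; last lin.
by twist_sums.
Qed.

(* Here [Ds] is applied to [beta psi^2 (a1) ∗ alpha psi omega^2 (b)]: the five
   summands come, in order, from those of [Delta_star_mul_sum]. *)
Lemma star_right_sum {U : lmodType K} (G : C -> C -> C -> U) c : trilin G ->
  tsum (Ds c) (fun x y => tsum (Ds y) (fun y1 y2 =>
    G (omega' (psi' x)) (omega' y1) y2)) =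
  nested_term G c
  + tsum (Ds c) (fun x y => tsum (Ds x) (fun x1 x2 =>
      G (psi' x1) (omega' x2) (psi' y)))
  + lambda *: weight_term G c
  + nested_term (swap12 G) c + lambda *: weight_term (swap12 G) c.
Proof.
(* Now every term on the right begins by splitting [c] and then [a], as the left side does, and the
   five can be compared one by one. *)
move=> GT; rewrite star_left_sum // nested_term_swap // weight_term_swap //.
rewrite Delta_star_sum /=; last lin.
rewrite /nested_term /weight_term !scale_tsum -!tsum_add; apply: eq_tsum => a b.
rewrite !scale_tsum -!tsum_add; apply: eq_tsum => a1 a2.
rewrite Delta_star_mul_sum; last lin.
congr (_ + _ + _ *: _ + _ + _ *: _).
- rewrite Delta_alpha_psi_omega2_sum; last lin.
  apply: eq_tsum => b1 b2; rewrite Delta_alpha_psi_omega2_sum; last lin.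
  by twist_sums.
- rewrite Delta_beta_psi2_sum; last lin.
  apply: eq_tsum => p q; rewrite Delta_alpha_psi_omega2_sum; last lin.
  by twist_sums.
- rewrite Delta_alpha_psi_omega2_sum; last lin.
  by twist_sums.
- rewrite Delta_beta_psi2_sum; last lin.
  apply: eq_tsum => p q; rewrite Delta_beta_psi2_sum; last lin.
  by twist_sums.
- rewrite Delta_beta_psi2_sum; last lin.
  by twist_sums.
Qed.

(** * Compatibility of [Delta_star] with its structure maps *)

Lemma Delta_psi'_sum {U : lmodType K} (f : C -> C -> U) c : bilin f ->
  tsum (Delta (psi' c)) f = tsum (Delta c) (fun x y => f (psi' x) (psi' y)).
Proof.
move=> fB; rewrite /= Delta_alpha_sum ?Delta_beta_sum ?Delta_psi_sum //; try lin.
by rewrite !Delta_omega_sum //; lin.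
Qed.

Lemma Delta_omega'_sum {U : lmodType K} (f : C -> C -> U) c : bilin f ->
  tsum (Delta (omega' c)) f = tsum (Delta c) (fun x y => f (omega' x) (omega' y)).
Proof. by move=> fB; rewrite /= Delta_psi_sum ?Delta_omega_sum //; lin. Qed.

(** All four twisting maps commute with [Delta] and with each other and are multiplicative, hence so
    are their composites [psi'] and, below, [omega']. *)
Lemma Delta_star_psi' c : Ds (psi' c) = tmap psi' psi' (Ds c).
Proof.
rewrite !Delta_starE Delta_psi'_sum; last lin.
rewrite linear_tsum; apply: eq_tsum => a b.
rewrite linear_tsum Delta_psi'_sum; last lin.
by apply: eq_tsum => a1 a2 /=; rewrite tmapE /= !twistE.
Qed.

Lemma Delta_star_omega' c : Ds (omega' c) = tmap omega' omega' (Ds c).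
Proof.
rewrite !Delta_starE Delta_omega'_sum; last lin.
rewrite linear_tsum; apply: eq_tsum => a b.
rewrite linear_tsum Delta_omega'_sum; last lin.
by apply: eq_tsum => a1 a2 /=; rewrite tmapE /= !twistE.
Qed.

(** * Invariance of [delta_bar] under the flip *)

Lemma delta_barE c :
  delta_bar Ds psi' omega' c =
  nested_term (fun x y z => x ⊗ y ⊗ z) c
  + lambda *: weight_term (fun x y z => x ⊗ y ⊗ z) c
  + (nested_term (fun x y z => y ⊗ x ⊗ z) c
     + lambda *: weight_term (fun x y z => y ⊗ x ⊗ z) c).
Proof.
set G := fun x y z : C => x ⊗ y ⊗ z.
have GT : trilin G by rewrite /G; lin.
have -> : delta_bar Ds psi' omega' c =
    tsum (Ds c) (fun x y => tsum (Ds y) (fun y1 y2 =>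
      G (omega' (psi' x)) (omega' y1) y2))
    - tsum (Ds c) (fun x y => tsum (Ds x) (fun x1 x2 =>
      G (psi' x1) (omega' x2) (psi' y))).
  rewrite /delta_bar !tmap_tsum; congr (_ - _).
    rewrite linear_tsum; apply: eq_tsum => x y /=.
    rewrite tmap_tsum !linear_tsum; apply: eq_tsum => y1 y2 /=.
    by rewrite tassoclE.
  by apply: eq_tsum => x y /=; rewrite tmap_tsum tsum_tensl.
rewrite star_right_sum //.
set s := tsum _ _; set a := nested_term _ _; set w := lambda *: _.
set a' := nested_term _ _; set w' := lambda *: _.
(* The second summand [s] is moved to the end, where it cancels the subtracted term. *)
by rewrite (addrAC a s w) (addrAC (a + w) s a') (addrAC (a + w + a') s w') addrK addrA.
Qed.

Lemma linear_nested_term {U X : lmodType K} (L : {linear U -> X})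
    (G : C -> C -> C -> U) (H : C -> C -> C -> X) c :
  (forall x y z, L (G x y z) = H x y z) -> L (nested_term G c) = nested_term H c.
Proof.
by move=> LG; rewrite /nested_term; do 4![rewrite linear_tsum; apply: eq_tsum => ? ?].
Qed.

Lemma linear_weight_term {U X : lmodType K} (L : {linear U -> X})
    (G : C -> C -> C -> U) (H : C -> C -> C -> X) c :
  (forall x y z, L (G x y z) = H x y z) -> L (weight_term G c) = weight_term H c.
Proof.
by move=> LG; rewrite /weight_term; do 3![rewrite linear_tsum; apply: eq_tsum => ? ?].
Qed.

Lemma Phi12_delta_bar c :
  Phi12 (delta_bar Ds psi' omega' c) = delta_bar Ds psi' omega' c.
Proof.
have Phi12E (x y z : C) : tmap (tflip C C) idfun (x ⊗ y ⊗ z) = y ⊗ x ⊗ z.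
  by rewrite tmapE /= tflipE.
(* The flip exchanges the two halves of [delta_barE], so one side is commuted before comparing
   termwise. *)
rewrite delta_barE [in RHS]addrC /Phi12 !linearD !linearZ.
by congr (_ + _ *: _ + (_ + _ *: _));
  (apply: linear_nested_term || apply: linear_weight_term) => x y z; apply: Phi12E.
Qed.

Lemma psi'_omega'C c : psi' (omega' c) = omega' (psi' c).
Proof. by rewrite /= !twistE. Qed.

End InfBH.

Theorem theorem3p39 (K : fieldType) (lambda : K) (C : lmodType K)
    (mu : {linear C ⨂ C -> C}) (Delta : {linear C -> C ⨂ C})
    (alpha beta psi omega : {linear C -> C})
    (hC : is_infBH_bialgebra lambda mu Delta alpha beta psi omega) :
  is_BiHom_preLie_coalgebra
    (Delta_star mu Delta alpha beta psi omega)
    (alpha \o beta \o psi \o psi \o omega \o omega)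
    (psi \o omega \o omega).
Proof.
split=> c.
- exact: psi'_omega'C hC c.
- exact: Delta_star_psi' hC c.
- exact: Delta_star_omega' hC c.
- by rewrite (Phi12_delta_bar hC) subrr.
Qed.
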